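(* Let $p\geqslant 11$ be a prime number with $p\equiv 1\bmod 5$, let $k$ be a primitive fifth root of unity in $\mathbb{Z}_{p^2}$, and let $\hat{\mathbf{G}}_1=\langle a,b,c : a^{p^2}=b^5=c^2=(ca)^2=[c,b]=1,\ bab^{-1}=a^k\rangle$. Up to duality, there are precisely two chiral pairs of orientably-regular maps of Euler characteristic $-2p^2$ of type $\{5,10\}$ with orientation-preserving automorphism group isomorphic to $\hat{\mathbf{G}}_1$.
   Context: A map $\mathscr{M}$ on a compact connected oriented surface $X$ is an embedding in $X$ of a finite connected graph whose complement is a disjoint union of topological discs, called faces. The Euler characteristic of the map is that of $X$. An automorphism of $\mathscr{M}$ is an incidence-preserving permutation of its edges, vertices and faces induced by a homeomorphism of $X$; $\mathrm{Aut}^+(\mathscr{M})$ is the group of those induced by orientation-preserving homeomorphisms. The map is orientably-regular if $\mathrm{Aut}^+(\mathscr{M})$ acts regularly on the set of arcs (edges endowed with a direction). Its type is $\{m,k\}$, where $k$ is the degree of each vertex and $m$ the size of each face. Equivalently, isomorphism classes of orientably-regular maps of type $\{m,k\}$ correspond to the finite index torsion-free normal subgroups $\Gamma$ of the triangle group $\Delta(2,m,k)=\langle y_1,y_2,y_3 : y_1^2=y_2^m=y_3^k=y_1y_2y_3=1\rangle$, with $\mathrm{Aut}^+(\mathscr{M})\cong\Delta(2,m,k)/\Gamma$. The dual map interchanges the roles of vertices and faces. An orientably-regular map is reflexive if it admits an orientation-reversing automorphism, and chiral otherwise; a chiral map $\mathscr{M}$ and its mirror image $\bar{\mathscr{M}}$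 form a chiral pair. Maps are counted up to orientation-preserving isomorphism. *)

(* Defs.v *)
From HB Require Import structures.
From mathcomp Require Import all_boot all_order all_algebra all_fingroup.

Set Implicit Arguments.
Unset Strict Implicit.
Unset Printing Implicit Defensive.

Import GroupScope.

(* A map on a compact connected oriented surface is represented by its rotation
   system.  The darts are the arcs of the embedded graph; [flip] reverses the
   direction of an arc, and [turn] sends an arc to the next one, counterclockwise
   with respect to the orientation of the surface, around its initial vertex.
   Thus vertices are the cycles of [turn] and edges those of [flip].  Loops and
   multiple edges are allowed; the connectedness axiom forces at least one dart,
   so the edgeless map on the sphere is left out. *)
Record orimap := OriMap {
  dart : finType;
  turn : {perm dart};
  flip : {perm dart};
  flipK : forall d, flip (flip d) = d;
  flip_neq : forall d, flip d != d;
  orimap_connected : [transitive <<[set turn; flip]>>, on [set: dart] | 'P]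
}.

(* [(s * t) d] is [t (s d)] for permutations, so [face d] is [turn^-1 (flip d)]:
   the arc that follows d on the boundary of the face to the left of d, that
   boundary being traversed counterclockwise.  Faces are the cycles of [face]. *)
Definition face (M : orimap) : {perm dart M} := flip M * (turn M)^-1.

Definition euler_char (M : orimap) : int :=
  (#|porbits (turn M)|%:Z - #|porbits (flip M)|%:Z + #|porbits (face M)|%:Z)%R.

(* type {m, k}: m is the size of the faces, k the degree of the vertices *)
Definition has_type (m k : nat) (M : orimap) : Prop :=
  forall d : dart M,
    #|porbit (face M) d| = m /\ #|porbit (turn M) d| = k.

(* Isomorphism of maps induced by an orientation-preserving homeomorphism. *)
Definition orimap_iso (M N : orimap) : Prop :=
  exists f : dart M -> dart N,
    [/\ bijective f,
        forall d, f (turn M d) = turn N (f d)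
      & forall d, f (flip M d) = flip N (f d)].

(* Aut^+(M): the permutations of the darts that commute with [turn] and [flip]. *)
Definition Autp (M : orimap) : {group {perm dart M}} :=
  'C([set turn M; flip M])%G.

Definition orientably_regular (M : orimap) : Prop :=
  [transitive Autp M, on [set: dart M] | 'P]
  /\ forall d : dart M, 'C_(Autp M)[d | 'P] = 1.

(* Orientation-reversing automorphisms turn counterclockwise rotation into
   clockwise rotation. *)
Definition reflexive_map (M : orimap) : Prop :=
  exists g : {perm dart M},
    (forall d, g (turn M d) = (turn M)^-1 (g d))
    /\ (forall d, g (flip M d) = flip M (g d)).

Definition chiral (M : orimap) : Prop := ~ reflexive_map M.

Lemma mirror_connected (M : orimap) :
  [transitive <<[set (turn M)^-1; flip M]>>, on [set: dart M] | 'P].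
Proof.
suff -> : <<[set (turn M)^-1; flip M]>> = <<[set turn M; flip M]>>
  by exact: orimap_connected.
have gR (x y : {perm dart M}) : y \in <<[set x; y]>>.
  by rewrite mem_gen // !inE eqxx orbT.
have gL (x y : {perm dart M}) : x \in <<[set x; y]>>.
  by rewrite mem_gen // !inE eqxx.
apply/eqP; rewrite eqEsubset !gen_subG !subUset !sub1set !gR !andbT.
by rewrite groupV gL -groupV gL.
Qed.

Definition mirror (M : orimap) : orimap :=
  OriMap (@flipK M) (@flip_neq M) (mirror_connected M).

Lemma dual_connected (M : orimap) :
  [transitive <<[set face M; flip M]>>, on [set: dart M] | 'P].
Proof.
suff -> : <<[set face M; flip M]>> = <<[set turn M; flip M]>>
  by exact: orimap_connected.
have gR (x : {perm dart M}) : flip M \in <<[set x; flip M]>>.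
  by rewrite mem_gen // !inE eqxx orbT.
have gL (x : {perm dart M}) : x \in <<[set x; flip M]>>.
  by rewrite mem_gen // !inE eqxx.
apply/eqP; rewrite eqEsubset !gen_subG !subUset !sub1set !gR !andbT.
apply/andP; split; first by rewrite groupM ?groupV ?gR ?gL.
by rewrite -groupV -(groupMl _ (gR (face M))) gL.
Qed.

(* The arc of the dual map attached to d crosses d from left to right, so that
   its initial vertex is the face to the left of d. *)
Definition dual (M : orimap) : orimap :=
  OriMap (@flipK M) (@flip_neq M) (dual_connected M).

(* M and N belong to the same chiral pair, that is, N is isomorphic to M or to
   its mirror image. *)
Definition same_pair (M N : orimap) : Prop :=
  orimap_iso N M \/ orimap_iso N (mirror M).

Definition same_pair_up_to_duality (M N : orimap) : Prop :=
  same_pair M N \/ same_pair (dual M) N.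

(* The group <a, b, c : a^(p^2) = b^5 = c^2 = (ca)^2 = [c, b] = 1,
   b a b^-1 = a^k>; the exponent k is taken as a natural number. *)
Definition isog_G1 (gT : finGroupType) (p k : nat) (G : {group gT}) : Prop :=
  G \isog Grp (a : b : c :
    a ^+ (p ^ 2)%N, b ^+ 5, c ^+ 2, (c * a) ^+ 2, [~ c, b],
    b * a * b^-1 = a ^+ k).

(* The maps to be counted: chiral orientably-regular maps of type {5, 10} and
   Euler characteristic -2p^2 whose group Aut^+ is the above group. *)
Definition chiral_G1_map (p k : nat) (M : orimap) : Prop :=
  [/\ orientably_regular M,
      euler_char M = (- (2 * p ^ 2)%N%:Z)%R,
      has_type 5 10 M,
      isog_G1 p k (Autp M)
    & chiral M].

(* Main.v *)
Require Import Defs.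
From mathcomp Require Import all_boot all_order all_algebra all_fingroup.
From mathcomp Require Import cyclic ring zify.

Set Implicit Arguments.
Unset Strict Implicit.
Unset Printing Implicit Defensive.

Import GroupScope GRing.Theory.

(** Put [n = p ^ 2] and [e = - k], a unit of order 10 of Z/n.  The group of the
    statement is Z/n extended by the cyclic group of order 10 acting through
    [e]: with [y = b^-1 c] it is presented by
    [x ^+ n = y ^+ 10 = 1, x ^ y = x ^+ e] ([homG_affineE]).

    The maps are Cayley maps of Z/n for the set of the ten powers of [e].  For
    [s] a unit of Z/10, the map M_s has a dart [(j, i)] for every [j] in Z/10
    and [i] in Z/n: it leaves the vertex [i] in the direction [- e ^ j].
    Turning around a vertex adds [s] to [j], and flipping gives
    [(j + 5, i - e ^ j)], because [e ^ 5 = -1].  The affine maps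
    [(j, i) |-> (j + a, e ^ a i + b)] are automorphisms of M_s for every [s],
    and they act regularly on the darts, so that Aut^+(M_s) is the required
    group.  Vertices have degree 10, and faces have size 5 because
    [1 + k + k^2 + k^3 + k^4 = 0] in Z/p^2; the latter follows from [k - 1]
    being invertible ([primitive_root5_sum]).

    The permutation [shift] (turn five times, then flip) maps [(j, i)] to
    [(j, i + e ^ j)] in M_s, whence
       [shift o turn = turn o shift ^ (e ^ s)].
    This relation is preserved by isomorphisms, and [shift] has order [n], so
    M_s determines [e ^ s], and hence [s] ([cayley_iso_exp]).  The mirror image
    of M_s being M_(-s), every M_s is chiral, and the units 1, 3, 7, 9 of Z/10
    give the two chiral pairs {M_1, M_9} and {M_3, M_7}.  Duality exchanges
    the types {5, 10} and {10, 5}, so it does not relate the two pairs.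

    Conversely, let N be a regular map as in the statement and [d0] a dart of
    N.  Let [r] and [l] be the automorphisms that map [d0] to the dart after it
    around its vertex and to its reverse.  They have orders 10 and 2.  In
    normal form [y ^+ j * x ^+ i] this forces [l = y ^+ 5 * x ^+ i] and
    [r = y ^+ s * x ^+ i'] with [s] a unit of Z/10, so that [l * r ^+ 5] is a
    power of [x] that [r] conjugates to its [e ^ s]-th power
    ([generator_exponent]).  Transported to darts, this is the relation above,
    and the relation reconstructs M_s ([cayley_of_shift_turn]).  *)

(** * Metacyclic groups *)

Section ModularExponents.

Variables (n : nat) (gT : finGroupType) (x : gT).
Hypotheses (n_gt1 : 1 < n) (xn : x ^+ n = 1).

Lemma expg_natZp m : x ^+ (m%:R : 'Z_n)%R = x ^+ m.
Proof. by rewrite val_Zp_nat // expg_mod. Qed.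

Lemma expg_addZp (u v : 'Z_n) : x ^+ (u + v)%R = x ^+ u * x ^+ v.
Proof.
by rewrite -[in LHS](natr_Zp u) -[in LHS](natr_Zp v) -natrD expg_natZp expgD.
Qed.

Lemma expg_oppZp (u : 'Z_n) : x ^+ (- u)%R = x ^- u.
Proof. by apply/esym/eqP; rewrite eq_invg_mul -expg_addZp subrr. Qed.

Lemma expg_expZp (u : 'Z_n) j : x ^+ (u ^ j)%N = x ^+ (u ^+ j)%R.
Proof. by rewrite -expg_natZp natrX natr_Zp. Qed.

End ModularExponents.

Lemma opp_exp5 n (k : 'Z_n) : (k ^+ 5 = 1)%R -> ((- k) ^+ 5 = -1)%R.
Proof. by move=> k5; rewrite exprNn k5 mulr1 -signr_odd. Qed.

Lemma opp_exp10 n (k : 'Z_n) : (k ^+ 5 = 1)%R -> ((- k) ^+ 10 = 1)%R.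
Proof. by move=> k5; rewrite (exprM _ 5 2) opp_exp5 // sqrrN expr1n. Qed.

Section Metacyclic.

Variables (gT : finGroupType) (x y : gT) (e : nat).
Hypothesis xy : x ^ y = x ^+ e.

Lemma conj_expgX i j : (x ^+ i) ^ (y ^+ j) = x ^+ (i * e ^ j).
Proof.
elim: j i => [|j IHj] i; first by rewrite conjg1 muln1.
by rewrite expgSr conjgM IHj conjXg xy -expgM mulnCA -expnS.
Qed.

Lemma metacyclic_mul j i j' i' :
  (y ^+ j * x ^+ i) * (y ^+ j' * x ^+ i')
    = y ^+ (j + j') * x ^+ (i * e ^ j' + i').
Proof.
by rewrite !expgD -conj_expgX !mulgA; congr (_ * _); rewrite -!mulgA -conjgC.
Qed.

Lemma metacyclic_exp j i m :
  exists i', (y ^+ j * x ^+ i) ^+ m = y ^+ (j * m) * x ^+ i'.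
Proof.
elim: m => [|m [i' IH]]; first by exists 0; rewrite muln0 !expg0 mulg1.
by exists (i' * e ^ j + i)%N; rewrite expgSr IH metacyclic_mul mulnS addnC.
Qed.

Lemma metacyclic_joing : <[x]> <*> <[y]> = <[y]> * <[x]>.
Proof. by rewrite joingC norm_joinEl // norms_cycle xy mem_cycle. Qed.

Lemma metacyclic_mem g :
  g \in <[x]> <*> <[y]> -> exists j i, g = y ^+ j * x ^+ i.
Proof.
rewrite metacyclic_joing => /mulsgP[_ _ /cycleP[j ->] /cycleP[i ->] ->].
by exists j, i.
Qed.

End Metacyclic.

(** The relations bound both cyclic orders, and the order of G makes these
    bounds sharp. *)
Lemma metacyclic_orders (gT : finGroupType) (G : {group gT}) n m e (x y : gT) :
    0 < n -> 0 < m ->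
    <[x]> <*> <[y]> = G -> #|G| = (n * m)%N ->
    [/\ x ^+ n = 1, y ^+ m = 1 & x ^ y = x ^+ e] ->
  [/\ #[x] = n, #[y] = m & #|<[y]> :&: <[x]>| = 1%N].
Proof.
move=> n0 m0 defG oG [xn ym xy].
have dx : #[x] %| n by rewrite order_dvdn xn.
have dy : #[y] %| m by rewrite order_dvdn ym.
have oxy : (#[y] * #[x] = #|G| * #|<[y]> :&: <[x]>|)%N.
  by rewrite -defG (metacyclic_joing xy) mul_cardG.
have I_gt0 : 0 < #|<[y]> :&: <[x]>| by rewrite cardG_gt0.
have lex := dvdn_leq n0 dx; have ley := dvdn_leq m0 dy.
have le : (m * n <= #[y] * #[x])%N by rewrite oxy oG mulnC leq_pmulr.
have Ex : #[x] = n.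
  apply/eqP; rewrite eqn_leq lex -(leq_pmul2l m0).
  by rewrite (leq_trans le) // leq_mul2r ley orbT.
have Ey : #[y] = m.
  by apply/eqP; rewrite eqn_leq ley -(leq_pmul2r n0) -{2}Ex.
split=> //; apply/eqP; rewrite -(@eqn_pmul2l (n * m)) ?muln_gt0 ?n0 //.
by rewrite -oG -oxy oG muln1 Ex Ey mulnC.
Qed.

(** A group of the largest order that the relations allow is the presented
    group: the normal forms are then unique, and sending generators to
    generators is a morphism on the semidirect product. *)
Lemma metacyclic_universal (gT rT : finGroupType) (G : {group gT})
    (H : {group rT}) n m e (x y : gT) :
    0 < n -> 0 < m ->
    <[x]> <*> <[y]> = G -> #|G| = (n * m)%N ->
    [/\ x ^+ n = 1, y ^+ m = 1 & x ^ y = x ^+ e] ->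
    H \homg Grp (x : y : x ^+ n, y ^+ m, x ^ y = x ^+ e) -> H \homg G.
Proof.
move=> n0 m0 defG oG [xn ym xy] /existsP[[x' y']] /= /eqP[defH x'n y'm x'y'].
have [ox oy I1] := metacyclic_orders n0 m0 defG oG (And3 xn ym xy).
have sdG : <[x]> ><| <[y]> = G.
  rewrite sdprodE ?norms_cycle ?xy ?mem_cycle //.
    by rewrite -defG norm_joinEr // norms_cycle xy mem_cycle.
  by rewrite setIC; apply: card1_trivg.
have fxP : #[x'] %| #[x] by rewrite order_dvdn ox x'n.
have fyP : #[y'] %| #[y] by rewrite order_dvdn oy y'm.
have fP : {in <[x]> & <[y]>, morph_act 'J 'J (eltm fxP) (eltm fyP)}.
  move=> _ _ /cycleP[i ->] /cycleP[j ->] /=.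
  by rewrite (conj_expgX xy) !eltmE (conj_expgX x'y').
apply/homgP; exists (sdprodm_morphism sdG fP).
rewrite /= im_sdprodm !morphim_cycle ?cycle_id //= !eltm_id -defH.
rewrite norm_joinEr //.
by rewrite norms_cycle x'y' mem_cycle.
Qed.

(** The two sets of generators correspond by [x = a], [y = b^-1 c], and
    [a = x], [b = y ^+ 4], [c = y ^+ 5]. *)
Lemma homG_affineE n (k : 'Z_n) (rT : finGroupType) (H : {group rT}) :
  1 < n -> (k ^+ 5 = 1)%R ->
  (H \homg Grp (a : b : c : a ^+ n, b ^+ 5, c ^+ 2, (c * a) ^+ 2, [~ c, b],
     b * a * b^-1 = a ^+ k))
  = (H \homg Grp (x : y : x ^+ n, y ^+ 10, x ^ y = x ^+ (- k)%R)).
Proof.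
move=> n1 k5; set e := nat_of_ord (- k)%R; apply/existsP/existsP.
  case=> -[[a b] c] /= /eqP[defH an b5 c2 ca2 /eqP/commgP cb bab].
  exists (a, b^-1 * c) => /=; apply/eqP.
  have cbV : commute b^-1 c by apply/commute_sym/commuteV.
  have cV : c^-1 = c by apply/eqP; rewrite eq_invg_mul -[_ * _]/(c ^+ 2) c2.
  have ac : a ^ c = a^-1.
    apply: (mulIg a); rewrite mulVg conjgE cV.
    by rewrite -[RHS]ca2 expgS expg1 !mulgA.
  have cbX i : (b^-1 * c) ^+ i = b ^- i * c ^+ i.
    by rewrite (expgMn _ cbV) expgVn.
  congr (_, (_, (_, _))) => //; last first.
  - have ab : a ^ b^-1 = a ^+ k by rewrite conjgE invgK mulgA bab.
    by rewrite conjgM ab conjXg ac expgVn /e expg_oppZp.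
  - by rewrite cbX (expgM b 5 2) (expgM c 2 5) b5 c2 !expg1n invg1 mulg1.
  - rewrite -defH -joingA; congr (_ <*> _); apply/eqP.
    rewrite eqEsubset cycle_subG join_subG !cycle_subG.
    have -> : b^-1 * c \in <[b]> <*> <[c]>.
      by rewrite groupM ?groupV // mem_gen // inE cycle_id ?orbT.
    have b4 : b ^- 4 = b by apply/eqP; rewrite eq_invg_mul -expgSr b5.
    have c4 : c ^+ 4 = 1 by rewrite (expgM c 2 2) c2 expg1n.
    rewrite /=; apply/andP; split; apply/cycleP; [exists 4 | exists 5];
      rewrite cbX.
      by rewrite b4 c4 mulg1.
    by rewrite b5 invg1 mul1g expgS c4 mulg1.
case=> -[x y] /= /eqP[defH xn y10 xy].
have conjx j : x ^ (y ^+ j) = x ^+ ((- k) ^+ j)%R.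
  by rewrite -[x in LHS]expg1 (conj_expgX xy) mul1n expg_expZp.
have cyy i j : commute (y ^+ i) (y ^+ j) by apply: commuteX2.
exists ((x, y ^+ 4), y ^+ 5) => /=; apply/eqP.
congr (_, (_, (_, (_, (_, (_, _)))))) => //.
- rewrite -defH -joingA; congr (_ <*> _); apply/eqP.
  rewrite eqEsubset cycle_subG join_subG !cycle_subG !mem_cycle /=.
  have yE : y ^+ 5 * y ^- 4 = y by rewrite expgS mulgK.
  rewrite -{1}yE.
  by rewrite groupM ?groupV // mem_gen // inE cycle_id ?orbT.
- by rewrite -expgM (expgM y 10 2) y10 expg1n.
- by rewrite -expgM y10.
- rewrite expgS expg1.
  have -> : y ^+ 5 * x * (y ^+ 5 * x) = x ^ (y ^+ 5) * x.
    have yV : (y ^+ 5)^-1 = y ^+ 5 by apply/eqP; rewrite eq_invg_mul -expgD y10.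
    by rewrite conjgE yV !mulgA.
  rewrite conjx (opp_exp5 k5) expg_oppZp // -[(1%R : 'Z_n)]/(1%:R)%R.
  by rewrite expg_natZp // mulVg.
- by apply/eqP/commgP.
have -> : y ^+ 4 * x * y ^- 4 = x ^ (y ^+ 6).
  have yV : y ^- 4 = y ^+ 6 by apply/eqP; rewrite eq_invg_mul -expgD y10.
  by rewrite -yV conjgE invgK mulgA.
by rewrite conjx exprS (opp_exp5 k5) mulrN1 opprK.
Qed.

Section AffineGroup.

Variables (n : nat) (k : 'Z_n) (gT : finGroupType) (G : {group gT}) (x y : gT).
Hypotheses (n_gt1 : 1 < n) (n_odd : odd n) (k5 : (5.-primitive_root k)%R).
Hypotheses (defG : <[x]> <*> <[y]> = G) (oG : #|G| = (n * 10)%N).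
Hypothesis xyP : [/\ x ^+ n = 1, y ^+ 10 = 1 & x ^ y = x ^+ (- k)%R].

(** The square of the element centralizes [x], so [k ^ (2 * j) = 1] and 5
    divides [j]; were [j] a multiple of 10, the element would be a power of [x],
    which has odd order. *)
Lemma involution_form j i :
  (y ^+ j * x ^+ i) ^+ 2 = 1 -> y ^+ j * x ^+ i <> 1 -> j = 5 %[mod 10].
Proof.
have [xn y10 xy] := xyP.
have [ox _ _] := metacyclic_orders (ltnW n_gt1) (isT : 0 < 10) defG oG xyP.
move=> g2 g1.
have j5 : 5 %| j.
  have: (k ^+ (2 * j) == 1)%R.
    have: x ^ ((y ^+ j * x ^+ i) ^+ 2) = x by rewrite g2 conjg1.
    have [i' ->] := metacyclic_exp xy j i 2.
    rewrite conjgM -[x in x ^ y ^+ _]expg1 (conj_expgX xy) mul1n expg_expZp //.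
    rewrite mulnC exprM sqrrN -exprM (conjgE (x ^+ _)).
    rewrite (commuteX2 _ _ (commute_refl x)) mulKg => /eqP.
    rewrite -[X in _ == X]expg1 eq_expg_mod_order ox.
    by rewrite -!val_Zp_nat // natr_Zp => /eqP/val_inj ->.
  by rewrite -(prim_order_dvd k5) Gauss_dvdr.
case/dvdnP: j5 => m jE; rewrite {}jE in g2 g1 *.
case modd: (odd m).
  by rewrite -[m]odd_double_half modd -muln2 mulnDl addnC -mulnA modnMDl.
case: g1.
have y1 : y ^+ (m * 5) = 1.
  by rewrite -[m]odd_double_half modd add0n -mul2n mulnAC expgM y10 expg1n.
move: g2; rewrite y1 mul1g => g2.
have : #[x ^+ i] %| gcdn n 2.
  by rewrite dvdn_gcd !order_dvdn g2 eqxx andbT -expgM mulnC expgM xn expg1n.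
have/eqP-> : coprime n 2 by rewrite coprimen2.
by rewrite dvdn1 order_eq1 => /eqP.
Qed.

(** Here [s] is the exponent of [y] in the normal form of [r].  It is odd since
    [r ^+ 5] is an involution, and it is not 5 modulo 10 because
    [y ^+ 5 * x ^+ i] is an involution; so it is a unit modulo 10. *)
Lemma generator_exponent r l :
    r \in G -> l \in G -> #[r] = 10 -> #[l] = 2 ->
  exists2 s : 'Z_10, s \is a GRing.unit &
    (l * r ^+ 5) ^+ n = 1 /\
    (l * r ^+ 5) ^ r = (l * r ^+ 5) ^+ ((- k) ^+ s)%R.
Proof.
have [xn y10 xy] := xyP.
move=> Gr Gl or ol.
have order_neq1 (g : gT) m : 0 < m < #[g] -> g ^+ m <> 1.
  case/andP=> m0 mg /eqP.
  by rewrite -order_dvdn => /(dvdn_leq m0); rewrite leqNgt mg.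
have r10 : r ^+ 10 = 1 by rewrite -or expg_order.
have l2 : l ^+ 2 = 1 by rewrite -ol expg_order.
have l1 : l <> 1 by rewrite -[l]expg1; apply: order_neq1; rewrite ol.
rewrite -defG in Gr Gl.
have e5 := opp_exp5 (prim_expr_order k5).
have e10 := opp_exp10 (prim_expr_order k5).
have [j [i rE]] := metacyclic_mem xy Gr.
have [m [i' lE]] := metacyclic_mem xy Gl.
have [i5 r5E] := metacyclic_exp xy j i 5; rewrite -rE in r5E.
have m5 : m = 5 %[mod 10] by apply: (@involution_form m i'); rewrite -lE.
have j5 : j * 5 = 5 %[mod 10].
  apply: (@involution_form _ i5); rewrite -r5E; last first.
    by apply: order_neq1; rewrite or.
  by rewrite -expgM.
have jN5 : j <> 5 %[mod 10].
  move=> jE; have: r ^+ 2 <> 1 by apply: order_neq1; rewrite or.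
  rewrite rE -(expg_mod j y10) jE expgS expg1 (metacyclic_mul xy) y10 mul1g.
  have -> : (i * (- k)%R ^ 5 + i = (- k)%R ^ 5 * i + i)%N by rewrite mulnC.
  rewrite expgD expgM expg_expZp // e5 expg_oppZp //.
  by rewrite (@expg_natZp _ _ _ _ _ 1) // expgVn mulVg.
have [i'' wE] : exists i'', l * r ^+ 5 = x ^+ i''.
  rewrite lE r5E (metacyclic_mul xy) -(expg_mod _ y10) -modnDm m5 j5.
  by exists (i' * (- k)%R ^ (j * 5) + i5)%N; rewrite mul1g.
exists (j%:R)%R; last split.
- rewrite unitZpE // -coprime_modr.
  move: jN5 j5; rewrite -modnMml; have := ltn_pmod j (isT : 0 < 10).
  by move: (j %% 10) => q; do 10?[case: q => [|q] //].
- by rewrite wE -expgM mulnC expgM xn expg1n.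
rewrite wE rE conjgM (conj_expgX xy) (conjgE (x ^+ _)).
rewrite (commuteX2 _ _ (commute_refl x)) mulKg.
rewrite expgM expg_expZp // ?val_Zp_nat ?expr_mod //.
by rewrite -expgM mulnC expgM xn expg1n.
Qed.

End AffineGroup.

(** * Isomorphisms and automorphisms of maps *)

Lemma perm_intertwineX (T U : finType) (f : T -> U) (s : {perm T})
    (t : {perm U}) m d :
  (forall d, f (s d) = t (f d)) -> f ((s ^+ m) d) = (t ^+ m) (f d).
Proof.
by move=> fs; rewrite !permX; elim: m => //= m <-.
Qed.

Lemma orimap_iso_sym M N : orimap_iso M N -> orimap_iso N M.
Proof.
case=> f [[g fK gK] fT fL]; exists g; split; first by exists f.
  by move=> d; rewrite -{1}(gK d) -fT fK.
by move=> d; rewrite -{1}(gK d) -fL fK.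
Qed.

Lemma orimap_iso_trans M N P :
  orimap_iso M N -> orimap_iso N P -> orimap_iso M P.
Proof.
case=> f [fB fT fL] [g [gB gT gL]]; exists (g \o f).
split=> [|d|d] /=; first exact: bij_comp.
  by rewrite fT gT.
by rewrite fL gL.
Qed.

Lemma perm_intertwineV (T U : finType) (f : T -> U) (s : {perm T})
    (t : {perm U}) :
  (forall d, f (s d) = t (f d)) -> forall d, f (s^-1 d) = t^-1 (f d).
Proof. by move=> fs d; apply: (@perm_inj _ t); rewrite -fs !permKV. Qed.

Lemma orimap_iso_dual M N : orimap_iso M N -> orimap_iso (dual M) (dual N).
Proof.
case=> f [fB fT fL]; exists f; split=> //= d.
by rewrite !permM (perm_intertwineV fT) fL.
Qed.

Lemma flipV M : (flip M)^-1 = flip M.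
Proof.
by apply/permP => d; apply: (@perm_inj _ (flip M)); rewrite permKV flipK.
Qed.

Lemma flip_bij M : bijective (flip M).
Proof. by exists (flip M); apply: flipK. Qed.

(** The rotation of the double dual is [flip * turn * flip]: the two maps are
    not equal, but [flip] is an isomorphism between them. *)
Lemma dual_dual_iso M : orimap_iso M (dual (dual M)).
Proof.
exists (flip M); split=> //= [|d]; first exact: flip_bij.
by rewrite /face /= /face invMg invgK flipV !permM flipK.
Qed.

Lemma dual_mirror_iso M : orimap_iso (dual (mirror M)) (mirror (dual M)).
Proof.
exists (flip M); split=> //= [|d]; first exact: flip_bij.
by rewrite /face /= invMg !invgK flipV !permM.
Qed.

Lemma AutpP M (g : {perm dart M}) :
  reflect ((forall d, g (turn M d) = turn M (g d)) /\
           (forall d, g (flip M d) = flip M (g d))) (g \in Autp M).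
Proof.
apply: (iffP centP) => [cg | [gT gL] h].
  have E h : h \in [set turn M; flip M] -> forall d, g (h d) = h (g d).
    by move=> /cg E d; rewrite -!permM E.
  by split; apply: E; rewrite !inE eqxx ?orbT.
by rewrite !inE => /orP[] /eqP->; apply/permP=> d; rewrite !permM.
Qed.

Lemma monodromy_reach M (d0 d : dart M) :
  exists2 h, h \in <<[set turn M; flip M]>> & h d0 = d.
Proof.
have [||h] := atransP2 (orimap_connected M) (_ : d0 \in _) (_ : d \in _).
- by rewrite inE.
- by rewrite inE.
by move=> Gh ->; exists h.
Qed.

(** An automorphism is known by the image of one dart, since it commutes with
    the transitive group generated by [turn] and [flip]. *)
Lemma Autp_free M (g h : {perm dart M}) d :
  g \in Autp M -> h \in Autp M -> g d = h d -> g = h.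
Proof.
move=> Ag Ah gh; apply/permP => d'.
have [u Gu <-] := monodromy_reach d d'.
have comm (v : {perm dart M}) : v \in Autp M -> forall c, v (u c) = u (v c).
  by rewrite /= -cent_gen => /centP/(_ _ Gu) E c; rewrite -!permM E.
by rewrite !comm // gh.
Qed.

Lemma Autp_semiregular M (d : dart M) : 'C_(Autp M)[d | 'P] = 1.
Proof.
apply/trivgP/subsetP => g /setIP[Ag /astab1P gd].
by rewrite inE; apply/eqP/(Autp_free Ag (group1 _) (d := d)); rewrite perm1.
Qed.

Lemma card_Autp M : [transitive Autp M, on [set: dart M] | 'P] ->
  #|Autp M| = #|dart M|.
Proof.
move=> tr; have [d0 _ orb] := imsetP tr.
by rewrite -(card_orbit_stab 'P _ d0) Autp_semiregular cards1 muln1 -orb cardsT.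
Qed.

Lemma transitive_from (T : finType) (G : {group {perm T}}) d0 :
  (forall d, exists2 g, g \in G & g d0 = d) -> [transitive G, on [set: T] | 'P].
Proof.
move=> reach; apply/imsetP; exists d0; rewrite ?inE //.
apply/setP => d; rewrite inE; apply/esym/orbitP.
by have [g Gg <-] := reach d; exists g.
Qed.

Lemma card_porbit_eq (T : finType) (s : {perm T}) x c :
  0 < c -> (s ^+ c) x = x -> (forall i, 0 < i < c -> (s ^+ i) x != x) ->
  #|porbit s x| = c.
Proof.
move=> c0 sc si; apply/eqP; rewrite eqn_leq; apply/andP; split; last first.
  rewrite leqNgt; apply/negP => lt.
  have /si/eqP[] : 0 < #|porbit s x| < c by rewrite lt lt0n card_porbit_neq0.
  by rewrite permX iter_porbit.
rewrite leqNgt; apply/negP => lt.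
have := nth_uniq x _ _ (uniq_traject_porbit s x).
move=> /(_ 0 c); rewrite size_traject lt (ltn_trans c0 lt) => /(_ isT isT).
rewrite !nth_traject ?(ltn_trans c0 lt) //= -permX sc eqxx => /esym/eqP E.
by rewrite -E in c0.
Qed.

Lemma card_porbits (T : finType) (s : {perm T}) c :
  (forall x, #|porbit s x| = c) -> (#|porbits s| * c)%N = #|T|.
Proof.
move=> sc; rewrite -[#|T|]cardsT.
have part : partition (porbits s) setT.
  have := @orbit_partition _ _ _ 'P <[s]>%G setT.
  have -> : [set orbit 'P <[s]>%G x | x in setT] = porbits s.
    apply/setP => A; apply/imsetP/imsetP=> -[x _ ->]; exists x;
      by rewrite ?inE ?porbitE.
  by apply; apply/actsP => g _ x; rewrite !inE.
by rewrite (card_uniform_partition _ part (n := c)) // => A /imsetP[x _ ->].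
Qed.

(** On the maps below five turns take a dart to the opposite one at the same
    vertex, and [shift] moves every dart to a neighbouring vertex, keeping its
    direction. *)
Definition shift (M : orimap) : {perm dart M} := turn M ^+ 5 * flip M.

Lemma shiftE M d : shift M d = flip M ((turn M ^+ 5) d).
Proof. exact: permM. Qed.

Lemma orimap_iso_shift M N (f : dart M -> dart N) :
    (forall d, f (turn M d) = turn N (f d)) ->
    (forall d, f (flip M d) = flip N (f d)) ->
  forall d, f (shift M d) = shift N (f d).
Proof. by move=> fT fL d; rewrite !shiftE fL (perm_intertwineX 5 d fT). Qed.

Lemma shift_turn_iso M N m :
    orimap_iso M N ->
    (forall d, shift M (turn M d) = turn M ((shift M ^+ m) d)) ->
  forall d, shift N (turn N d) = turn N ((shift N ^+ m) d).
Proof.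
case=> f [[g fK gK] fT fL] relM d; rewrite -(gK d).
have fW := orimap_iso_shift fT fL.
by rewrite -fT -fW relM fT (perm_intertwineX _ _ fW).
Qed.

(** * The Cayley maps *)

Section CayleyMap.

Variables (n : nat) (k : 'Z_n).
Hypotheses (n_gt1 : 1 < n) (k5 : (k ^+ 5 = 1)%R).

Local Notation e := (- k)%R.
Local Notation darts := ('Z_10 * 'Z_n)%type.

(** A power with exponent in Z/10 is taken at the representative in 0, ..., 9;
    the usual laws hold because [e ^ 10 = 1]. *)
Lemma exp_addZ10 (a b : 'Z_10) : (e ^+ (a + b)%R = e ^+ a * e ^+ b)%R.
Proof. by rewrite -exprD -(expr_mod (a + b)%N (opp_exp10 k5)). Qed.

Lemma exp_natZ10 m : (e ^+ (m%:R : 'Z_10) = e ^+ m)%R.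
Proof. by rewrite val_Zp_nat // expr_mod // (opp_exp10 k5). Qed.

Lemma exp_mulnZ10 (a : 'Z_10) l : (e ^+ (a *+ l)%R = (e ^+ a) ^+ l)%R.
Proof. by rewrite -[a in LHS]natr_Zp -mulrnA exp_natZ10 exprM. Qed.

Lemma exp_add5 (a : 'Z_10) : (e ^+ (a + 5%:R)%R = - e ^+ a)%R.
Proof. by rewrite exp_addZ10 exp_natZ10 (opp_exp5 k5) mulrN1. Qed.

Definition rotate (s : 'Z_10) (d : darts) : darts := (d.1 + s, d.2)%R.
Definition reverse (d : darts) : darts := (d.1 + 5%:R, d.2 - e ^+ d.1)%R.

Lemma rotate_inj s : injective (rotate s).
Proof.
move=> [j i] [j' i'] /pair_equal_spec /= [/addIr -> ->] //.
Qed.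

Lemma reverseK : involutive reverse.
Proof.
case=> j i; rewrite /reverse /= exp_add5 opprK subrK -addrA -natrD.
by congr (_, _); rewrite -[RHS]addr0; congr (_ + _)%R; apply/val_inj.
Qed.

Definition rotate_perm s : {perm darts} := perm (@rotate_inj s).
Definition reverse_perm : {perm darts} := perm (inv_inj reverseK).

Lemma reverse_permK d : reverse_perm (reverse_perm d) = d.
Proof. by rewrite !permE reverseK. Qed.

Lemma reverse_neq d : reverse_perm d != d.
Proof.
rewrite permE; case: d => j i; apply/eqP; case=> /(congr1 (fun a => a - j)%R).
by rewrite addrC addKr subrr.
Qed.

Lemma unitZ10_cases (s : 'Z_10) :
  s \is a GRing.unit -> [\/ s = 1%:R, s = 3%:R, s = - 3%:R | s = - 1%:R]%R.
Proof.
rewrite -{1}(natr_Zp s) unitZpE //.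
case: s => m lt_m /=; do 10?[case: m lt_m => [|m] lt_m //] => _.
- by apply: Or41; apply/val_inj.
- by apply: Or42; apply/val_inj.
- by apply: Or43; apply/val_inj.
- by apply: Or44; apply/val_inj.
Qed.

Lemma rotate_permX s m j i : (rotate_perm s ^+ m) (j, i) = (j + s *+ m, i)%R.
Proof.
rewrite permX; elim: m => [|m IH]; first by rewrite addr0.
by rewrite iterS IH permE /rotate [RHS]/= mulrSr addrA.
Qed.

Lemma reverse_permE j i : reverse_perm (j, i) = (j + 5%:R, i - e ^+ j)%R.
Proof. by rewrite permE. Qed.

(** This is [shift] for the map M_s, needed already to prove that map
    connected. *)
Definition translate_perm s : {perm darts} := rotate_perm s ^+ 5 * reverse_perm.

Lemma unitZ10_mul5 (s : 'Z_10) : s \is a GRing.unit -> (s *+ 5 = 5%:R)%R.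
Proof. by case/unitZ10_cases=> ->; apply/val_inj. Qed.

Lemma translate_permE s j i : s \is a GRing.unit ->
  translate_perm s (j, i) = (j, i + e ^+ j)%R.
Proof.
move=> us; rewrite permM rotate_permX reverse_permE unitZ10_mul5 //.
rewrite exp_add5 opprK.
by rewrite -addrA -natrD (_ : (5 + 5)%:R = 0)%R ?addr0 //; apply/val_inj.
Qed.

Lemma translate_permX s m j i : s \is a GRing.unit ->
  (translate_perm s ^+ m) (j, i) = (j, i + e ^+ j *+ m)%R.
Proof.
move=> us; rewrite permX; elim: m => [|m IH]; first by rewrite addr0.
by rewrite iterS IH translate_permE // mulrSr addrA.
Qed.

Lemma cayley_reach s j i :
  s \is a GRing.unit ->
  (translate_perm s ^+ (i : 'Z_n) * rotate_perm s ^+ (s^-1 * j : 'Z_10)%R)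
    (0, 0)%R = (j, i).
Proof.
move=> us; rewrite permM translate_permX // rotate_permX expr0 !add0r.
by rewrite natr_Zp -mulr_natr natr_Zp mulVKr.
Qed.

Lemma cayley_connected s : s \is a GRing.unit ->
  [transitive <<[set rotate_perm s; reverse_perm]>>, on [set: darts] | 'P].
Proof.
move=> us; apply: (transitive_from (d0 := (0, 0)%R)) => -[j i].
eexists; last exact: cayley_reach us.
by rewrite !(groupM, groupX) // mem_gen // !inE eqxx ?orbT.
Qed.

Definition cayley_map s (us : s \is a GRing.unit) : orimap :=
  OriMap reverse_permK reverse_neq (cayley_connected us).

Lemma cayley_shift_turn s (us : s \is a GRing.unit) (d : dart (cayley_map us)) :
  let M := cayley_map us in
  shift M (turn M d) = turn M ((shift M ^+ (e ^+ s)%R) d).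
Proof.
case: d => j i; rewrite /= -/(translate_perm s).
rewrite -[rotate_perm s (j, i)]/((rotate_perm s ^+ 1) (j, i)) rotate_permX.
have -> : shift (cayley_map us) = translate_perm s by [].
rewrite translate_permE // translate_permX // permE /rotate [RHS]/=.
by rewrite -mulr_natr natr_Zp -exp_addZ10.
Qed.

(** Isomorphisms preserve the relation between [shift] and [turn], and comparing
    the two relations at the dart [(0, 0)] yields the equality, since [shift]
    translates that dart by 1. *)
Lemma cayley_iso_exp s s' (us : s \is a GRing.unit)
    (us' : s' \is a GRing.unit) :
  orimap_iso (cayley_map us) (cayley_map us') -> (e ^+ s = e ^+ s')%R.
Proof.
move/shift_turn_iso/(_ (@cayley_shift_turn s us)).
move=> /(_ (0, 0)%R); rewrite cayley_shift_turn => /perm_inj.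
have -> : shift (cayley_map us') = translate_perm s' by [].
rewrite !translate_permX // => /(congr1 snd) /=.
by rewrite !add0r expr0 !natr_Zp.
Qed.

Lemma cayley_mirror s (us : s \is a GRing.unit)
    (usN : (- s)%R \is a GRing.unit) :
  orimap_iso (mirror (cayley_map us)) (cayley_map usN).
Proof.
exists id; split=> // [|d]; first by exists id.
case: d => j i; apply: (@perm_inj _ (rotate_perm s)).
rewrite /= permKV !permE /rotate /=.
by congr (_, _); rewrite subrK.
Qed.

(** Squaring turns powers of [- k] into powers of [k]; this gives equality
    modulo 5, which suffices as units modulo 10 are odd. *)
Lemma exp_unit_inj (s s' : 'Z_10) : (5.-primitive_root k)%R ->
  s \is a GRing.unit -> s' \is a GRing.unit -> (e ^+ s = e ^+ s')%R -> s = s'.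
Proof.
move=> kp us us' /(congr1 (fun z => z ^+ 2)%R).
rewrite -!exprM ![(_ * 2)%N]mulnC !exprM sqrrN -!exprM => /eqP.
rewrite (eq_prim_root_expr kp).
by case/unitZ10_cases: us => ->; case/unitZ10_cases: us' => -> //.
Qed.

(** A reflection would identify M_s with its mirror image M_(-s). *)
Lemma cayley_chiral s (us : s \is a GRing.unit) :
  (5.-primitive_root k)%R -> chiral (cayley_map us).
Proof.
move=> kp [g [gT gL]].
have usN : (- s)%R \is a GRing.unit by rewrite unitrN.
have /cayley_iso_exp/(exp_unit_inj kp us usN) :
    orimap_iso (cayley_map us) (cayley_map usN).
  apply: (orimap_iso_trans _ (cayley_mirror us usN)).
  by exists g; split=> //; exists g^-1 => d; rewrite ?permK ?permKV.
by case/unitZ10_cases: (us) => ->.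
Qed.

Lemma card_cayley s (us : s \is a GRing.unit) :
  #|dart (cayley_map us)| = (n * 10)%N.
Proof. by rewrite card_prod !card_ord !Zp_cast // mulnC. Qed.

Lemma cayley_card_vertex s (us : s \is a GRing.unit)
    (d : dart (cayley_map us)) :
  #|porbit (turn (cayley_map us)) d| = 10.
Proof.
case: d => j i; apply: card_porbit_eq => // [|m lt_m]; rewrite /= rotate_permX.
  by rewrite -mulr_natr (_ : 10%:R = 0)%R ?mulr0 ?addr0 //; apply/val_inj.
apply/eqP => /(congr1 fst)/= /(congr1 (fun a => - j + a)%R).
rewrite addKr addNr.
case/unitZ10_cases: (us) => ->; move: m lt_m; do 11?[case=> //].
Qed.

Lemma cayley_card_edge s (us : s \is a GRing.unit) (d : dart (cayley_map us)) :
  #|porbit (flip (cayley_map us)) d| = 2.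
Proof.
apply: card_porbit_eq => // [|[|[|m]] //].
  by rewrite permX /= reverse_permK.
by rewrite expg1 flip_neq.
Qed.

Lemma face_permX s m j i (us : s \is a GRing.unit) :
  (face (cayley_map us) ^+ m) (j, i)
    = (j + (5%:R - s) *+ m,
       i - e ^+ j * \sum_(l < m) e ^+ ((5%:R - s) *+ l)%R)%R.
Proof.
elim: m => [|m IH]; first by rewrite big_ord0 mulr0 subr0 addr0 perm1.
rewrite expgSr permM IH [face _ _]permM /= reverse_permE.
apply: (@perm_inj _ (rotate_perm s)).
rewrite permKV -[rotate_perm s _]/((rotate_perm s ^+ 1) _) rotate_permX.
congr (_, _).
  by rewrite mulr1n [((_ - _) *+ m.+1)%R]mulrSr !addrA subrK.
by rewrite exp_addZ10 big_ord_recr /= mulrDr opprD !addrA.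
Qed.

(** For the four units [s], the ratio [e ^ (5 - s)] of the geometric sum
    collected along a face is a power [k ^ a] with [a] prime to 5, so after five
    steps the sum is [1 + k + k^2 + k^3 + k^4]. *)
Lemma cayley_card_face s (us : s \is a GRing.unit) (d : dart (cayley_map us)) :
  (1 + k + k ^+ 2 + k ^+ 3 + k ^+ 4 = 0)%R ->
  #|porbit (face (cayley_map us)) d| = 5.
Proof.
move=> k0.
case: d => j i; apply: card_porbit_eq => // [|m lt_m]; rewrite face_permX.
  congr (_, _).
    case/unitZ10_cases: (us) => ->; rewrite -[RHS]addr0; congr (_ + _)%R;
      exact: val_inj.
  rewrite -[RHS]subr0; congr (_ - _)%R.
  rewrite [X in (_ * X)%R](_ : _ = 0)%R ?mulr0 //.
  have kmod a : (k ^+ a = k ^+ (a %% 5))%R by rewrite (expr_mod _ k5).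
  have even m : (e ^+ (2 * m) = k ^+ (2 * m))%R by rewrite !exprM sqrrN.
  have [a a4 ea] : exists2 a, 0 < a < 5 & (e ^+ (5%:R - s)%R = k ^+ a)%R.
    case/unitZ10_cases: (us) => ->;
      [exists 4 | exists 2 | exists 3 | exists 1%N] => //.
    - exact: (even 2).
    - exact: (even 1%N).
    - by rewrite (kmod 3) -(kmod 8); apply: (even 4).
    - by rewrite (kmod 1%N) -(kmod 6); apply: (even 3).
  under eq_bigr => l _ do rewrite exp_mulnZ10 ea -exprM kmod.
  rewrite !big_ord_recr big_ord0 -[RHS]k0 /=.
  by move: a a4 {ea}; do 5?[case=> //]; move=> *; rewrite /=; ring.
apply/eqP => /(congr1 fst)/= /(congr1 (fun a => - j + a)%R).
rewrite addKr addNr.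
case/unitZ10_cases: (us) => ->; move: m lt_m; do 11?[case=> //].
Qed.

(** These generate the automorphism group.  They are independent of the rotation
    [s]: all the maps M_s have the same automorphisms. *)
Definition slide (d : darts) : darts := (d.1, d.2 + 1)%R.
Definition dilate (d : darts) : darts := (d.1 + 1, e * d.2)%R.

Lemma slide_inj : injective slide.
Proof. by move=> [j i] [j' i'] /pair_equal_spec /= [-> /addIr ->]. Qed.

Lemma dilate_inj : injective dilate.
Proof.
move=> [j i] [j' i'] /pair_equal_spec /= [/addIr -> /(congr1 ( *%R (e ^+ 9)))].
by rewrite !mulrA -exprSr (opp_exp10 k5) !mul1r => ->.
Qed.

Definition slide_perm : {perm darts} := perm slide_inj.
Definition dilate_perm : {perm darts} := perm dilate_inj.

Lemma slide_permX m j i : (slide_perm ^+ m) (j, i) = (j, i + m%:R)%R.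
Proof.
rewrite permX; elim: m => [|m IH]; first by rewrite addr0.
by rewrite iterS IH permE /slide -[m.+1%:R%R]natr1 addrA.
Qed.

Lemma dilate_permX m j i : (dilate_perm ^+ m) (j, i) = (j + m%:R, e ^+ m * i)%R.
Proof.
rewrite permX; elim: m => [|m IH]; first by rewrite addr0 mul1r.
by rewrite iterS IH permE /dilate -[m.+1%:R%R]natr1 addrA exprS mulrA.
Qed.

Lemma slide_Autp s (us : s \is a GRing.unit) :
  slide_perm \in Autp (cayley_map us).
Proof.
apply/AutpP; split=> -[j i]; first by rewrite /= !permE.
by rewrite -[slide_perm]expg1 !(reverse_permE, slide_permX) addrAC.
Qed.

Lemma dilate_Autp s (us : s \is a GRing.unit) :
  dilate_perm \in Autp (cayley_map us).
Proof.
have dilateE j i : dilate_perm (j, i) = (j + 1, e * i)%R by rewrite permE.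
have e1 (j : 'Z_10) : (e ^+ (j + 1)%R = e * e ^+ j)%R.
  by rewrite addrC exp_addZ10; congr (_ * _)%R; apply: (exp_natZ10 1%N).
apply/AutpP; split=> -[j i].
  have rotateE j' i' : rotate_perm s (j', i') = (j' + s, i')%R by rewrite permE.
  by rewrite !(rotateE, dilateE) addrAC.
by rewrite !(reverse_permE, dilateE) e1 mulrBr addrAC.
Qed.

Lemma cayley_Autp_reach s (us : s \is a GRing.unit) (d : dart (cayley_map us)) :
  exists2 g, g \in <[dilate_perm]> * <[slide_perm]> & g (0, 0)%R = d.
Proof.
case: d => j i; exists (dilate_perm ^+ j * slide_perm ^+ i).
  by apply: mem_mulg; apply: mem_cycle.
by rewrite permM dilate_permX slide_permX mulr0 !add0r !natr_Zp.
Qed.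

Lemma slide_dilate :
  [/\ slide_perm ^+ n = 1, dilate_perm ^+ 10 = 1
    & slide_perm ^ dilate_perm = slide_perm ^+ e].
Proof.
split.
- apply/permP => -[j i].
  by rewrite slide_permX perm1 -(natr_Zp (n%:R)%R) val_Zp_nat // modnn addr0.
- apply/permP => -[j i]; rewrite dilate_permX perm1.
  rewrite (opp_exp10 k5) mul1r (_ : 10%:R = 0)%R ?addr0 //.
  exact: val_inj.
apply: (mulgI dilate_perm); rewrite conjgE mulKVg; apply/permP => -[j i].
rewrite [LHS]permM [RHS]permM -(expg1 dilate_perm) -[slide_perm in LHS]expg1.
by rewrite slide_permX !dilate_permX slide_permX natr_Zp mulrDr mulr1.
Qed.

Lemma cayley_Autp_gen s (us : s \is a GRing.unit) :
  <[slide_perm]> <*> <[dilate_perm]> = Autp (cayley_map us).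
Proof.
have [_ _ conj] := slide_dilate.
apply/eqP; rewrite eqEsubset join_subG !cycle_subG slide_Autp dilate_Autp /=.
apply/subsetP => g Ag; rewrite (metacyclic_joing conj).
have [h Hh hg] := cayley_Autp_reach (g (0, 0)%R : dart (cayley_map us)).
suff -> : g = h by [].
apply: (@Autp_free (cayley_map us) g h (0, 0)%R Ag _ (esym hg)).
case/mulsgP: Hh => _ _ /cycleP[a ->] /cycleP[b ->] ->.
by rewrite groupM ?groupX ?slide_Autp ?dilate_Autp.
Qed.

Lemma cayley_regular s (us : s \is a GRing.unit) :
  orientably_regular (cayley_map us).
Proof.
split; last exact: Autp_semiregular.
apply: (transitive_from (d0 := (0, 0)%R)) => d.
have [_ _ conj] := slide_dilate.
have [g Hg gd] := @cayley_Autp_reach s us d; exists g => //.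
by rewrite -cayley_Autp_gen (metacyclic_joing conj).
Qed.

Lemma card_cayley_Autp s (us : s \is a GRing.unit) :
  #|Autp (cayley_map us)| = (n * 10)%N.
Proof. by rewrite card_Autp ?card_cayley //; case: (cayley_regular us). Qed.

Lemma cayley_isoGrp s (us : s \is a GRing.unit) :
  Autp (cayley_map us) \isog Grp (a : b : c : a ^+ n, b ^+ 5, c ^+ 2,
     (c * a) ^+ 2, [~ c, b], b * a * b^-1 = a ^+ k).
Proof.
apply: intro_isoGrp => [|rT H]; rewrite homG_affineE //.
  apply/existsP; exists (slide_perm, dilate_perm); apply/eqP => /=.
  have [xn y10 xy] := slide_dilate.
  congr (_, (_, (_, _))) => //; exact: cayley_Autp_gen.
exact: (metacyclic_universal (ltnW n_gt1) (isT : 0 < 10) (cayley_Autp_gen us)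
  (card_cayley_Autp us) slide_dilate).
Qed.

Lemma cayley_has_type s (us : s \is a GRing.unit) :
  (1 + k + k ^+ 2 + k ^+ 3 + k ^+ 4 = 0)%R -> has_type 5 10 (cayley_map us).
Proof. by move=> k0 d; rewrite cayley_card_face // cayley_card_vertex. Qed.

Lemma cayley_euler_char s (us : s \is a GRing.unit) :
  (1 + k + k ^+ 2 + k ^+ 3 + k ^+ 4 = 0)%R ->
  euler_char (cayley_map us) = (- (2 * n)%N%:Z)%R.
Proof.
move=> k0; rewrite /euler_char.
have V := card_porbits (@cayley_card_vertex s us).
have E := card_porbits (@cayley_card_edge s us).
have F := card_porbits (fun d => @cayley_card_face s us d k0).
move: V E F; rewrite card_cayley.
move: #|_| #|_| #|_| => V E F /eqP; rewrite eqn_pmul2r // => /eqP ->.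
lia.
Qed.

(** Every dart of N is [turn ^ a (shift ^ i d0)], and the relations say how
    [turn] and [flip] = [turn ^ 5] followed by [shift] act on these
    expressions; so sending [(j, i)] to
    [turn ^ (j / s) (shift ^ i d0)] commutes with both.  Its image is stable
    under the transitive group they generate, and the cardinals agree. *)
Lemma cayley_of_shift_turn (s : 'Z_10) (us : s \is a GRing.unit) N :
    turn N ^+ 10 = 1 -> shift N ^+ n = 1 ->
    (forall d, shift N (turn N d) = turn N ((shift N ^+ (e ^+ s)%R) d)) ->
    #|dart N| = (n * 10)%N ->
  orimap_iso (cayley_map us) N.
Proof.
move=> T10 Wn rel card.
set T := turn N in T10 rel *; set W := shift N in Wn rel *.
have conjW : W ^ T^-1 = W ^+ (e ^+ s)%R.
  rewrite conjgE invgK mulgA; apply: (mulIg T); rewrite mulgKV.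
  by apply/permP => d; rewrite [LHS](permM T W) rel [RHS]permM.
have TW (a : 'Z_10) : T ^+ a * W = W ^+ (e ^+ (s * a)%R)%R * T ^+ a.
  have := conj_expgX conjW 1 a.
  rewrite expg1 mul1n expg_expZp // expgVn conjgE invgK mulgA.
  move=> /(congr1 (mulg^~ (T ^+ a))); rewrite mulgKV => ->.
  by rewrite -exp_mulnZ10 -mulr_natr natr_Zp.
have flipE : flip N = T ^+ 5 * W.
  by rewrite /W /shift mulgA -expgD T10 mul1g.
have [d0 _ _] := imsetP (orimap_connected N).
pose f (d : dart (cayley_map us)) := (W ^+ d.2 * T ^+ (s^-1 * d.1)%R) d0.
have T_addZ10 (a b : 'Z_10) : T ^+ (a + b)%R = T ^+ a * T ^+ b.
  exact: expg_addZp.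
have fT d : f (turn (cayley_map us) d) = T (f d).
  case: d => j i; rewrite -[turn _ _]/(rotate_perm s (j, i)) permE /f.
  rewrite -permM -mulgA.
  by rewrite [fst _]/= [snd _]/= mulrDr mulVr // T_addZ10.
have fL d : f (flip (cayley_map us) d) = flip N (f d).
  case: d => j i; rewrite -[flip _ _]/(reverse_perm (j, i)) reverse_permE.
  rewrite flipE /f -permM.
  rewrite [fst _]/= [snd _]/= mulrDr mulr_natr unitZ10_mul5 ?unitrV //.
  have -> : T ^+ 5 = T ^+ (5%:R : 'Z_10)%R by [].
  rewrite -mulgA (mulgA (T ^+ _)) -T_addZ10 TW mulrDr mulVKr // mulr_natr.
  by rewrite unitZ10_mul5 // exp_add5 mulgA expg_addZp.
have fonto d : d \in codom f.
  pose S := [set z | z \in codom f].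
  have stabS : <<[set T; flip N]>> \subset 'N(S | 'P).
    rewrite gen_subG; apply/subsetP => h hTL; rewrite !inE /=.
    apply/subsetP => _ /[!inE] /codomP[z ->]; rewrite apermE.
    by case/set2P: hTL => ->; rewrite -?fT -?fL codom_f.
  have [h Hh <-] := monodromy_reach d0 d.
  have : 'P%act d0 h \in S.
    rewrite (astabs_act _ (subsetP stabS h Hh)) inE.
    apply/codomP; exists (0, 0)%R.
    by rewrite /f [fst _]/= [snd _]/= mulr0 mulg1 perm1.
  by rewrite inE.
exists f; split=> //.
have fI : injective f.
  suff /image_injP fP :
      #|image f predT| == #|(predT : pred (dart (cayley_map us)))|.
    by move=> z z'; apply: fP.
  rewrite eqn_leq leq_image_card -[X in (X <= _)%N]/#|dart (cayley_map us)|.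
  by rewrite card_cayley -card; apply/subset_leq_card/subsetP => d _.
by apply: (inj_card_bij fI); rewrite card card_cayley.
Qed.

(** Evaluation at [d0] is a bijection from Aut^+(N) to the darts under which
    [turn] and [shift] become left multiplication by [r] and by [l * r ^+ 5];
    the relation provided by [generator_exponent] thus holds for them. *)
Lemma regular_map_is_cayley N :
    odd n -> (5.-primitive_root k)%R ->
    orientably_regular N -> has_type 5 10 N ->
    Autp N \isog Grp (a : b : c : a ^+ n, b ^+ 5, c ^+ 2, (c * a) ^+ 2,
     [~ c, b], b * a * b^-1 = a ^+ k) ->
  exists s (us : s \is a GRing.unit), orimap_iso (cayley_map us) N.
Proof.
move=> n_odd kp [trN _] typeN isoN.
have [d0 _ _] := imsetP (orimap_connected N).
have card_A : #|Autp N| = (n * 10)%N.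
  have u1 : (1 : 'Z_10)%R \is a GRing.unit by apply: unitr1.
  rewrite -(card_cayley_Autp u1); apply: card_isog.
  rewrite isogEhom (cayley_isoGrp u1) (isoGrp_hom isoN) /=.
  by rewrite isoN (isoGrp_hom (cayley_isoGrp u1)).
have := isoGrp_hom isoN; rewrite homG_affineE //.
case/existsP=> -[x y] /= /eqP[defA xn y10 xy].
have reach d : exists2 g, g \in Autp N & g d0 = d.
  have [||g Ag ->] := atransP2 trN (_ : d0 \in _) (_ : d \in _);
    rewrite ?inE //.
  by exists g.
have [r Ar rd] := reach (turn N d0).
have [l Al ld] := reach (flip N d0).
have A_turn g m d : g \in Autp N -> g ((turn N ^+ m) d) = (turn N ^+ m) (g d).
  by case/AutpP=> gT _; apply: perm_intertwineX.
have rX m : (r ^+ m) d0 = (turn N ^+ m) d0.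
  elim: m => [|m IH]; first by rewrite !perm1.
  by rewrite expgS permM rd -(expg1 (turn N)) A_turn ?groupX // IH -permM
    -expgSr.
have or : #[r] = 10.
  have [_ <-] := typeN d0; apply/esym/card_porbit_eq => // [|i /andP[i0 lt_i]].
    by rewrite -rX expg_order perm1.
  apply/eqP; rewrite -rX => ri; suff : r ^+ i = 1.
    by move/eqP; rewrite -order_dvdn => /(dvdn_leq i0); rewrite leqNgt lt_i.
  by apply: (@Autp_free _ _ _ d0); rewrite ?groupX ?group1 // perm1.
have A_flip g d : g \in Autp N -> g (flip N d) = flip N (g d) by case/AutpP.
have ol : #[l] = 2.
  apply: nt_prime_order => //.
    apply: (@Autp_free _ _ _ d0); rewrite ?groupX ?group1 //.
    by rewrite expgS expg1 permM ld A_flip // ld flipK perm1.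
  by apply/eqP=> l1; have := flip_neq d0; rewrite -ld l1 perm1 eqxx.
have [s us [wn wr]] := generator_exponent n_gt1 n_odd kp defA card_A
  (And3 xn y10 xy) Ar Al or ol.
set w := l * r ^+ 5 in wn wr.
have wd : w d0 = flip N ((turn N ^+ 5) d0).
  by rewrite [LHS](permM l) ld A_flip ?groupX // rX.
have Wg g : g \in Autp N -> forall m, (shift N ^+ m) (g d0) = (w ^+ m * g) d0.
  move=> Ag; have Aw : w \in Autp N by rewrite groupM ?groupX.
  elim=> [|m IH]; first by rewrite perm1 mul1g.
  have Awm : w ^+ m * g \in Autp N by rewrite groupM ?groupX.
  rewrite expgSr permM IH shiftE -A_turn // -A_flip //.
  by rewrite -wd (expgS w) -mulgA [RHS]permM.
have Tg g : g \in Autp N -> turn N (g d0) = (r * g) d0.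
  by case/AutpP=> gT _; rewrite permM rd gT.
exists s, us; apply: cayley_of_shift_turn.
- by apply/permP => d; have [_ <-] := typeN d; rewrite permX iter_porbit perm1.
- by apply/permP => d; have [g Ag <-] := reach d; rewrite Wg // wn mul1g perm1.
- move=> d; have [g Ag <-] := reach d.
  have Awm m : w ^+ m * g \in Autp N.
    by rewrite !groupM ?groupX ?groupM ?groupX.
  rewrite Tg // Wg // Tg // -(expg1 (shift N)) Wg ?groupM // expg1.
    by rewrite !mulgA [w * r]conjgC wr.
- by rewrite -card_Autp.
Qed.

End CayleyMap.

(** * The two chiral pairs *)

(** Were [k - 1] not invertible, it would be a multiple of [p], hence of square
    zero, and [k ^ p = 1 + p (k - 1) = 1]; but 5 does not divide [p].  So
    [k - 1] can be cancelled in [k ^ 5 - 1 = 0]. *)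
Lemma primitive_root5_sum (p : nat) (k : 'Z_(p ^ 2)) :
  prime p -> p = 1 %[mod 5] -> (5.-primitive_root k)%R ->
  (1 + k + k ^+ 2 + k ^+ 3 + k ^+ 4 = 0)%R.
Proof.
move=> pp p5 kp.
have q1 : 1 < p ^ 2 by rewrite (@ltn_exp2l p 0) ?prime_gt1.
have k5 := prim_expr_order kp.
have ku : (k - 1)%R \is a GRing.unit.
  rewrite -(natr_Zp (k - 1)%R) unitZpE // coprimeXl // prime_coprime //.
  apply/negP => /dvdnP[t ut].
  set u := (k - 1)%R in ut.
  have uE : u = ((t * p)%:R)%R by rewrite -ut natr_Zp.
  have p20 : ((p ^ 2)%:R = 0 :> 'Z_(p ^ 2))%R.
    by apply/val_inj; rewrite /= val_Zp_nat // modnn.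
  have u2 : (u * u = 0)%R.
    have -> : (u * u = (t * t)%:R * (p ^ 2)%:R)%R.
      by rewrite uE -!natrM; congr (_%:R)%R; lia.
    by rewrite p20 mulr0.
  have kE m : (k ^+ m = 1 + u *+ m)%R.
    have -> : k = (1 + u)%R by rewrite /u addrC subrK.
    elim: m => [|m IH]; first by rewrite addr0.
    rewrite exprS IH mulrDr mulr1 mulrDl mul1r mulrnAr u2 mul0rn addr0.
    by rewrite -addrA -mulrS.
  have : (k ^+ p == 1)%R.
    by rewrite kE -mulr_natr uE -natrM -mulnA mulnn natrM p20 mulr0 addr0.
  rewrite -(prim_order_dvd kp) => /dvdnP[c pE].
  by move: p5; rewrite pE modnMl.
apply: (mulrI ku); rewrite mulr0.
have -> : ((k - 1) * (1 + k + k ^+ 2 + k ^+ 3 + k ^+ 4) = k ^+ 5 - 1)%R by ring.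
by rewrite k5 subrr.
Qed.

Lemma has_type_faceX m k M (d : dart M) :
  has_type m k M -> (face M ^+ m) d = d.
Proof. by move=> /(_ d) [<- _]; rewrite permX iter_porbit. Qed.

Lemma not_iso_of_turn5 M N (d : dart N) :
    (forall d, (turn M ^+ 5) d = d) -> #|porbit (turn N) d| = 10 ->
  ~ orimap_iso N M.
Proof.
move=> M5 oN [f [/bij_inj fI fT _]].
suff : (turn N ^+ 5) d = d.
  have := uniq_traject_porbit (turn N) d; rewrite oN /= !permX /= => + E.
  by rewrite E !inE eqxx ?orbT.
by apply: fI; rewrite (perm_intertwineX _ _ fT) M5.
Qed.

Theorem corollaryA2 (p : nat) (k : 'Z_(p ^ 2))
  (hp : prime p) (hp11 : 11 <= p) (hp5 : p = 1 %[mod 5])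
  (hk : (5.-primitive_root k)%R) :
  exists M1 M2 : orimap,
    [/\ chiral_G1_map p k M1,
        chiral_G1_map p k M2,
        ~ same_pair_up_to_duality M1 M2
      & forall N : orimap,
          chiral_G1_map p k N \/ chiral_G1_map p k (dual N) ->
          same_pair_up_to_duality M1 N \/ same_pair_up_to_duality M2 N].
Proof.
have n1 : 1 < p ^ 2 by rewrite (@ltn_exp2l p 0) ?prime_gt1.
have n_odd : odd (p ^ 2).
  by rewrite oddX; case: (even_prime hp) hp11 => // ->.
have k5 := prim_expr_order hk.
have k0 := primitive_root5_sum hp hp5 hk.
have cayleyP (s : 'Z_10) (us : s \is a GRing.unit) :
    chiral_G1_map p k (cayley_map k5 us).
  split.
  - exact: cayley_regular.
  - exact: cayley_euler_char.
  - exact: cayley_has_type.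
  - exact: cayley_isoGrp.
  - exact: cayley_chiral.
have u1 : (1%:R : 'Z_10)%R \is a GRing.unit by rewrite unitZpE.
have u3 : (3%:R : 'Z_10)%R \is a GRing.unit by rewrite unitZpE.
have u1N : (- 1%:R : 'Z_10)%R \is a GRing.unit by rewrite unitrN.
set M1 := cayley_map k5 u1; set M2 := cayley_map k5 u3.
exists M1, M2; split; [exact: cayleyP | exact: cayleyP | |].
- have d0 : dart M2 := (0, 0)%R.
  have [_ _ t1 _ _] := cayleyP _ u1; have [_ _ t2 _ _] := cayleyP _ u3.
  have [_ oN] := t2 d0.
  have face5 d : (face M1 ^+ 5) d = d by apply: has_type_faceX t1.
  have neq s (us : s \is a GRing.unit) :
      3%:R%R <> s -> ~ orimap_iso M2 (cayley_map k5 us).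
    by move=> ns /(cayley_iso_exp)/(exp_unit_inj hk u3 us).
  case=> -[].
  + exact: neq.
  + move/orimap_iso_trans/(_ (cayley_mirror k5 u1 u1N)).
    exact: neq.
  (* The rotation of the dual of M1 is the face permutation of M1, of order 5,
     whereas the rotation of M2 has cycles of length 10. *)
  + exact: (not_iso_of_turn5 (M := dual M1) face5 oN).
  + apply: (not_iso_of_turn5 (M := mirror (dual M1)) _ oN) => d /=.
    by apply: (@perm_inj _ (face M1 ^+ 5)); rewrite expgVn permKV face5.
have classify N : chiral_G1_map p k N ->
    exists M, [\/ M = M1 | M = M2] /\ same_pair M N.
  case=> regN _ tN isoN _.
  have [s [us iso]] := regular_map_is_cayley n1 k5 n_odd hk regN tN isoN.
  have iso' := orimap_iso_sym iso.
  have mir := cayley_mirror k5.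
  (* Modulo 10 the units 7 and 9 are -3 and -1, the mirror images of 3 and 1. *)
  case: (unitZ10_cases us) => sE; subst s.
  - by exists M1; split; [left | left; rewrite /M1 (bool_irrelevance u1 us)].
  - by exists M2; split; [right | left; rewrite /M2 (bool_irrelevance u3 us)].
  - exists M2; split; first by right.
    by right; apply: orimap_iso_trans iso' (orimap_iso_sym (mir _ u3 us)).
  - exists M1; split; first by left.
    by right; apply: orimap_iso_trans iso' (orimap_iso_sym (mir _ u1 us)).
(* When the dual of N has type {5, 10}, dualize its isomorphism back to N. *)
move=> N [/classify | /classify] [M [eM pM]].
  by case: eM => <-; [left | right]; left.
suff : same_pair_up_to_duality M N by case: eM => <-; [left | right].
right; case: pM => iso; [left | right];
  apply: (orimap_iso_trans (dual_dual_iso N)).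
  exact: orimap_iso_dual.
exact: orimap_iso_trans (orimap_iso_dual iso) (dual_mirror_iso M).
Qed.
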